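(* Let $n\ge 1$. Then $$\mathrm{sat}^{lin}_3(n, \text{Berge-}C_4)\leq \begin{cases} \lfloor\frac{5(n-1)}{6}\rfloor, & n\equiv1, 15, 16 \pmod{18};\\ \lfloor\frac{5(n-2)}{6}\rfloor, & n\equiv0, 2, 3, 4, 5, 6, 7, 17 \pmod{18};\\ \lfloor\frac{5(n-3)}{6}\rfloor, & n\equiv8, 9, 10, 11, 12, 13 \pmod{18};\\ \lfloor\frac{5(n-4)}{6}\rfloor, & n\equiv14 \pmod{18}. \end{cases}$$
   Context: A hypergraph $H=(V(H),E(H))$ is $3$-uniform if every hyperedge is a $3$-element subset of $V(H)$, and linear if any two distinct hyperedges share at most one vertex. A Berge cycle Berge-$C_\ell$ of length $\ell$ in $H$ is an alternating sequence $(v_1,e_1,v_2,e_2,\dots,v_\ell,e_\ell)$ of distinct vertices $v_i$ and distinct hyperedges $e_i$ of $H$ with $v_i,v_{i+1}\in e_i$ for $1\le i\le \ell-1$ and $v_\ell,v_1\in e_\ell$. A linear $3$-uniform hypergraph $H$ is linear Berge-$C_4$-saturated if $H$ contains no Berge-$C_4$, but for every $e\in\binom{V(H)}{3}\setminus E(H)$ such that $H+e$ is still linear, $H+e$ contains a Berge-$C_4$. The linear saturation number $\mathrm{sat}^{lin}_3(n,\text{Berge-}C_4)$ is the minimum number of hyperedges of an $n$-vertex linear $3$-uniform hypergraph that is linear Berge-$C_4$-saturated.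
   Formalization: The case n = 3 is excluded: there the stated bound is 0, but the edgeless hypergraph on 3 vertices is not saturated (adding the only triple creates no Berge-C_4), so the saturation number is 1. *)

(* Defs.v *)
From mathcomp Require Import all_boot.

Set Implicit Arguments.
Unset Strict Implicit.
Unset Printing Implicit Defensive.

(* A hypergraph on the vertex set T is its set of hyperedges E : {set {set T}}. *)
Section Hypergraph.

Variable T : finType.
Implicit Types (E : {set {set T}}) (e f : {set T}).

Definition uniform (r : nat) E : bool := [forall e in E, #|e| == r].

Definition linear_hypergraph E : bool :=
  [forall e in E, forall f in E, (e != f) ==> (#|e :&: f| <= 1)].

(* Vertices and hyperedges are indexed by 'I_l instead of 1..l; ordS is the
   cyclic successor on 'I_l, so i = l-1 gives the closing condition. *)
Definition has_berge_cycle (l : nat) E : bool :=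
  [exists v : {ffun 'I_l -> T}, [exists e : {ffun 'I_l -> {set T}},
    [&& injectiveb v, injectiveb e &
        [forall i, [&& e i \in E, v i \in e i & v (ordS i) \in e i]]]]].

Definition linear_berge_C4_saturated E : bool :=
  [&& uniform 3 E, linear_hypergraph E, ~~ has_berge_cycle 4 E &
      [forall e : {set T},
        [&& #|e| == 3, e \notin E & linear_hypergraph (e |: E)] ==>
        has_berge_cycle 4 (e |: E)]].

Lemma ex_linear_berge_C4_saturated :
  exists m, [exists E, linear_berge_C4_saturated E && (#|E| == m)].
Proof.
pose P E := [&& uniform 3 E, linear_hypergraph E & ~~ has_berge_cycle 4 E].
have P0 : P set0.
  apply/and3P; split; try by apply/forall_inP => e; rewrite inE.
  apply/existsP => -[v /existsP[e /and3P[_ _ /forallP/(_ ord0)]]].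
  by rewrite inE.
have [E /maxsetP[/and3P[uE lE nE] maxE] _] := maxset_exists P0.
exists #|E|; apply/existsP; exists E; rewrite eqxx andbT.
apply/and4P; split=> //; apply/forallP => e.
apply/implyP => /and3P[e3 eNE leE]; apply: contraNT eNE => nC.
rewrite -(maxE (e |: E)) ?setU11 ?subsetUr //.
apply/and3P; split=> //; apply/forall_inP => f /setU1P[-> //|].
exact: (forall_inP uE).
Qed.

End Hypergraph.

Definition sat_lin3_berge_C4 (n : nat) : nat :=
  ex_minn (ex_linear_berge_C4_saturated 'I_n).

(* For n >= 1 the truncated subtractions below are never actually truncated.
   At n = 3 this bound is 0, whereas sat_lin3_berge_C4 3 = 1: the edgeless
   hypergraph on 3 vertices is not saturated, since adding its only triple
   creates no Berge-C_4. *)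
Definition sat_bound (n : nat) : nat :=
  let r := n %% 18 in
  if r \in [:: 1; 15; 16] then (5 * (n - 1)) %/ 6
  else if r \in [:: 0; 2; 3; 4; 5; 6; 7; 17] then (5 * (n - 2)) %/ 6
  else if r \in [:: 8; 9; 10; 11; 12; 13] then (5 * (n - 3)) %/ 6
  else (5 * (n - 4)) %/ 6.

(* Main.v *)
(* Adding an edge to a linear hypergraph creates a Berge-C_4 as soon as two of its
   vertices are joined by a Berge path of length 3. Take a vertex 0 and a simple
   cubic graph whose nodes are disjoint triples of the other vertices; the three
   vertices of a triple are the half-edges at that node, and each edge of the
   graph becomes a hyperedge containing 0 and its two half-edges. This has
   5/6 (n - 1) edges, and every vertex reaches 0 by Berge paths of length 1 and of
   length 2. Hence gluing such a hypergraph at 0 to a saturated one in which every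
   vertex reaches 0 in one or two steps preserves saturation: a path of length 1
   or 2 on one side is completed to length 3 on the other. Gluing copies obtained
   from K_4 and K_{3,3} adds 6t vertices and 5t edges for every t <> 1, so only
   finitely many starting hypergraphs, chosen to save edges in each class
   modulo 6, have to be examined. *)
Require Import Defs.
From mathcomp Require Import all_boot.
From mathcomp Require Import zify.

Set Implicit Arguments.
Unset Strict Implicit.
Unset Printing Implicit Defensive.

(** * Berge paths and cycles for edges given as lists, in a form that can be evaluated *)

Section EdgeLists.

Variable T : eqType.
Implicit Types (E : seq (seq T)) (u w : T).

Definition adjacent E u w : bool := has (fun e : seq T => (u \in e) && (w \in e)) E.

Definition berge_path2 E u w : bool :=
  has (fun e : seq T => has (fun f : seq T => (e != f) &&
    has (fun x => (x \in f) && uniq [:: u; x; w]) e)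
    [seq f : seq T <- E | w \in f]) [seq e : seq T <- E | u \in e].

(** The two end edges are selected by [u] and [w] before the middle edge runs over [E], which keeps
    evaluation cheap. *)
Definition berge_path3 E u w : bool :=
  has (fun e : seq T => has (fun g : seq T => has (fun f : seq T => uniq [:: e; f; g] &&
    has (fun x => (x \in f) &&
      has (fun y => (y \in f) && uniq [:: u; x; y; w]) g) e)
    E) [seq g : seq T <- E | w \in g]) [seq e : seq T <- E | u \in e].

Definition linked E u w : bool := adjacent E u w || berge_path3 E u w.

Definition linear_edges E : bool :=
  all (fun e : seq T => all (fun f : seq T => (e == f) ||
    all (fun x => all (fun y => [|| x == y, x \notin f | y \notin f]) e) e) E) E.

(** A Berge 4-cycle is cut open at one of its edges [e]: what remains is a path of length 3 avoiding
    [e] between two distinct vertices of [e]. *)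
Definition C4_free E : bool :=
  all (fun e : seq T => all (fun u => all (fun w =>
    (u == w) || ~~ berge_path3 [seq f : seq T <- E | f != e] u w) e) e) E.

Lemma adjacentP E u w :
  reflect (exists e : seq T, [/\ e \in E, u \in e & w \in e]) (adjacent E u w).
Proof.
apply: (iffP hasP) => [[e eE /andP[ue we]]|[e [eE ue we]]]; exists e => //.
by rewrite ue.
Qed.

Lemma berge_path2P E u w :
  reflect (exists (e f : seq T) x, [/\ e \in E, f \in E, e != f, uniq [:: u; x; w] &
             [/\ u \in e, x \in e, x \in f & w \in f]])
          (berge_path2 E u w).
Proof.
apply: (iffP hasP) => [[e]|[e [f [x [eE fE nef uq [ue xe xf wf]]]]]].
  rewrite mem_filter => /andP[ue eE] /hasP[f].
  rewrite mem_filter => /andP[wf fE] /andP[nef /hasP[x xe /andP[xf uq]]].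
  by exists e, f, x.
exists e; first by rewrite mem_filter ue.
apply/hasP; exists f; first by rewrite mem_filter wf.
by rewrite nef; apply/hasP; exists x => //; rewrite xf.
Qed.

Lemma berge_path3P E u w :
  reflect (exists (e f g : seq T) x y,
             [/\ [/\ e \in E, f \in E & g \in E], uniq [:: e; f; g],
                 uniq [:: u; x; y; w], [/\ u \in e, x \in e & x \in f] &
                 [/\ y \in f, y \in g & w \in g]])
          (berge_path3 E u w).
Proof.
apply: (iffP hasP) => [[e]|].
  rewrite mem_filter => /andP[ue eE] /hasP[g].
  rewrite mem_filter => /andP[wg gE] /hasP[f fE /andP[uqe]].
  by move=> /hasP[x xe /andP[xf /hasP[y yg /andP[yf uq]]]]; exists e, f, g, x, y.
move=> [e [f [g [x [y [[eE fE gE] uqe uq [ue xe xf] [yf yg wg]]]]]]].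
exists e; first by rewrite mem_filter ue.
apply/hasP; exists g; first by rewrite mem_filter wg.
apply/hasP; exists f => //; rewrite uqe; apply/hasP; exists x => //.
by rewrite xf; apply/hasP; exists y => //; rewrite yf.
Qed.

Lemma linear_edgesP E :
  reflect {in E &, forall e f : seq T, e != f ->
             forall x y, x \in e -> x \in f -> y \in e -> y \in f -> x = y}
          (linear_edges E).
Proof.
apply: (iffP allP) => [lin e f eE fE nef x y xe xf ye yf|lin e eE].
  move: (lin e eE) => /allP/(_ f fE); rewrite (negPf nef) /=.
  by move=> /allP/(_ x xe)/allP/(_ y ye); rewrite xf yf !orbF => /eqP.
apply/allP => f fE; case: (eqVneq e f) => //= nef.
apply/allP => x xe; apply/allP => y ye.
case xf: (x \in f); rewrite ?orbT //=; case yf: (y \in f); rewrite ?orbT //= orbF.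
by apply/eqP; apply: (lin e f).
Qed.

Lemma C4_freeP E :
  reflect (forall (e1 e2 e3 e4 : seq T) x1 x2 x3 x4,
             [/\ e1 \in E, e2 \in E, e3 \in E & e4 \in E] ->
             uniq [:: e1; e2; e3; e4] -> uniq [:: x1; x2; x3; x4] ->
             [/\ x1 \in e1, x2 \in e1, x2 \in e2 & x3 \in e2] ->
             [/\ x3 \in e3, x4 \in e3, x4 \in e4 & x1 \in e4] -> False)
          (C4_free E).
Proof.
apply: (iffP allP) => [free|free e eE].
  move=> e1 e2 e3 e4 x1 x2 x3 x4 [e1E e2E e3E e4E] uqe uqx.
  move=> [x11 x21 x22 x32] [x33 x43 x44 x14].
  have n14: (x1 == x4) = false by apply: contraTF uqx => /eqP->; rewrite /= !inE eqxx !orbT.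
  move: (free e4 e4E) => /allP/(_ x1 x14)/allP/(_ x4 x44); rewrite n14 /=.
  move/negP; apply; apply/berge_path3P; exists e1, e2, e3, x2, x3.
  move: uqe; rewrite /= !mem_filter !inE !negb_or !andbT.
  move=> /andP[/and3P[-> -> ->] /andP[/andP[-> ->] ->]].
  by split; rewrite ?e1E ?e2E ?e3E //; move: uqx; rewrite /= !inE !negb_or !andbT.
apply/allP => u ue; apply/allP => w we; case: (eqVneq u w) => //= nuw.
apply/negP => /berge_path3P[e1 [e2 [e3 [x [y [[]]]]]]].
rewrite !mem_filter => /andP[n1 e1E] /andP[n2 e2E] /andP[n3 e3E] uqe uqx.
move=> [u1 x1 x2] [y2 y3 w3].
apply: (free e1 e2 e3 e u x y w) => //.
move: uqe; rewrite /= !inE !negb_or !andbT => /andP[/andP[-> ->] ->].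
by rewrite n1 n2 n3.
Qed.

Lemma berge_path2_sub E E' u w : {subset E <= E'} ->
  berge_path2 E u w -> berge_path2 E' u w.
Proof.
move=> sEE' /berge_path2P[e [f [x [eE fE nef uq H]]]].
by apply/berge_path2P; exists e, f, x; rewrite !sEE'.
Qed.

Lemma adjacent_sub E E' u w : {subset E <= E'} ->
  adjacent E u w -> adjacent E' u w.
Proof.
by move=> sEE' /adjacentP[e [eE ue we]]; apply/adjacentP; exists e; rewrite sEE'.
Qed.

Lemma linked_sub E E' u w : {subset E <= E'} -> linked E u w -> linked E' u w.
Proof.
move=> sEE' /orP[/(adjacent_sub sEE') ad|]; first by rewrite /linked ad.
move=> /berge_path3P[e [f [g [x [y [[eE fE gE] uqe uqx H1 H2]]]]]].
by apply/orP; right; apply/berge_path3P; exists e, f, g, x, y; rewrite !sEE'.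
Qed.

Lemma adjacent_sym E u w : adjacent E u w = adjacent E w u.
Proof. by apply: eq_has => e; rewrite andbC. Qed.

Lemma linked_sym E u w : linked E u w = linked E w u.
Proof.
rewrite /linked adjacent_sym; congr orb.
suff imp a b : berge_path3 E a b -> berge_path3 E b a by apply/idP/idP; apply: imp.
move=> /berge_path3P[e [f [g [x [y [[eE fE gE] uqe uqx [? ? ?] [? ? ?]]]]]]].
apply/berge_path3P; exists g, f, e, y, x; split=> //.
  by rewrite -(rev_uniq [:: e; f; g]) in uqe.
by rewrite -(rev_uniq [:: a; x; y; b]) in uqx.
Qed.

End EdgeLists.

(** * Invariance under injective renaming of vertices *)

Definition relabel (T U : eqType) (h : T -> U) (E : seq (seq T)) : seq (seq U) :=
  [seq [seq h x | x <- e] | e <- E].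

Section Relabel.

Variables (T U : eqType) (h : T -> U).
Hypothesis h_inj : injective h.
Implicit Types (E : seq (seq T)) (u w : T).

Let hs_inj : injective (map h) := inj_map h_inj.

Lemma relabel_adjacent E u w : adjacent E u w -> adjacent (relabel h E) (h u) (h w).
Proof.
move=> /adjacentP[e [eE ue we]]; apply/adjacentP; exists [seq h x | x <- e].
by rewrite !map_f.
Qed.

Lemma relabel_path2 E u w :
  berge_path2 E u w -> berge_path2 (relabel h E) (h u) (h w).
Proof.
move=> /berge_path2P[e [f [x [eE fE nef uq [ue xe xf wf]]]]].
apply/berge_path2P; exists (map h e), (map h f), (h x).
by rewrite !map_f ?(inj_eq hs_inj) // -(map_inj_uniq h_inj) in uq *.
Qed.

Lemma relabel_linked E u w : linked E u w -> linked (relabel h E) (h u) (h w).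
Proof.
case/orP=> [/relabel_adjacent ad|]; first by rewrite /linked ad.
move=> /berge_path3P[e [f [g [x [y [[eE fE gE] uqe uqx [? ? ?] [? ? ?]]]]]]].
apply/orP; right; apply/berge_path3P; exists (map h e), (map h f), (map h g), (h x), (h y).
by rewrite -(map_inj_uniq h_inj) -(map_inj_uniq hs_inj) in uqx uqe *; rewrite !map_f.
Qed.

Lemma relabel_linear E : linear_edges E -> linear_edges (relabel h E).
Proof.
move=> /linear_edgesP lin; apply/linear_edgesP => _ _ /mapP[e eE ->] /mapP[f fE ->].
rewrite (inj_eq hs_inj) => nef _ _ /mapP[x xe ->] + /mapP[y ye ->].
by rewrite !(mem_map h_inj) => xf yf; congr h; apply: (lin e f).
Qed.

Lemma relabel_C4_free E : C4_free E -> C4_free (relabel h E).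
Proof.
move=> /C4_freeP free; apply/C4_freeP => e1 e2 e3 e4 x1 x2 x3 x4.
move=> [/mapP[f1 f1E ->] /mapP[f2 f2E ->] /mapP[f3 f3E ->] /mapP[f4 f4E ->]] uqe uqx.
case=> /mapP[y1 y11 def1] /mapP[y2 y21 def2] + /mapP[y3 y32 def3].
move: uqx; rewrite {}def1 {}def2 {}def3 => uqx.
rewrite (mem_map h_inj) => y22 [+ /mapP[y4 y43 def4]].
move: uqx; rewrite {}def4 !(mem_map h_inj) => uqx y33 y44 y14.
apply: (free f1 f2 f3 f4 y1 y2 y3 y4) => //.
  by rewrite -(map_inj_uniq hs_inj).
by rewrite -(map_inj_uniq h_inj).
Qed.

End Relabel.

(** * From edge lists to saturated hypergraphs on ['I_k.+1] *)

Definition edges_in (k : nat) (E : seq (seq nat)) : bool :=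
  all (fun e => [&& size e == 3, uniq e & all (leq^~ k) e]) E.

(** The parameter [k] is the largest vertex. It counts the vertices other than the center 0, so it
    is additive when two hypergraphs are glued at 0. *)
Definition all_vertices (k : nat) (P : pred nat) : bool := all P (iota 0 k.+1).

Lemma all_verticesP k (P : pred nat) :
  reflect (forall u, u <= k -> P u) (all_vertices k P).
Proof.
apply: (iffP allP) => HP u; first by move=> uk; apply: HP; rewrite mem_iota.
by rewrite mem_iota => /andP[_ uk]; apply: HP.
Qed.

(* Adjacent vertices count as linked because a new edge containing both would
   break linearity. *)
Definition saturated_edges (k : nat) (E : seq (seq nat)) : bool :=
  [&& edges_in k E, linear_edges E, C4_free E &
      all_vertices k (fun u => all_vertices k (fun v =>
        [|| u == v, linked E u v | all_vertices k (fun w =>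
          [|| w == u, w == v, linked E u w | linked E v w])]))].

Section Saturation.

Variables (k : nat) (E : seq (seq nat)).
Hypotheses (E_in : edges_in k E) (E_lin : linear_edges E).

Definition edge_set (e : seq nat) : {set 'I_k.+1} := [set v : 'I_k.+1 | val v \in e].

Definition edge_sets : {set {set 'I_k.+1}} := [set A in map edge_set E].

Lemma edges_inP e : e \in E ->
  [/\ size e = 3, uniq e & forall x, x \in e -> x <= k].
Proof. by move/(allP E_in) => /and3P[/eqP ? ? /allP]. Qed.

Lemma card_edge_set e : e \in E -> #|edge_set e| = 3.
Proof.
move=> /edges_inP[e3 uqe le_k].
pose e' : seq 'I_k.+1 := pmap insub e.
have -> : #|edge_set e| = #|e'|.
  by apply: eq_card => v; rewrite inE mem_pmap_sub.
rewrite (card_uniqP _) ?pmap_sub_uniq // size_pmap_sub -e3.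
by apply/eqP; rewrite -all_count; apply/allP => x /le_k; rewrite ltnS.
Qed.

Lemma edge_setsP A : reflect (exists2 e, e \in E & A = edge_set e) (A \in edge_sets).
Proof. by rewrite inE; apply: mapP. Qed.

(** Two lists could present the same triple in different orders; linearity excludes this, since they
    would share three vertices. *)
Lemma edge_set_inj : {in E &, injective edge_set}.
Proof.
move=> e f eE fE eq_ef; apply/eqP; apply: contraT => nef.
suff: #|edge_set e| <= 1 by rewrite card_edge_set.
apply/card_le1_eqP => x y xe ye; apply: val_inj.
have xf := xe; have yf := ye; rewrite {}eq_ef in xf yf.
rewrite !inE in xe ye xf yf.
exact: (linear_edgesP _ E_lin e f).
Qed.

Lemma edge_sets_uniform : uniform 3 edge_sets.
Proof. by apply/forall_inP => _ /edge_setsP[e eE ->]; rewrite card_edge_set. Qed.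

Lemma edge_sets_linear : linear_hypergraph edge_sets.
Proof.
apply/forall_inP => _ /edge_setsP[e eE ->].
apply/forall_inP => _ /edge_setsP[f fE ->]; apply/implyP => nef.
have {}nef : e != f by apply: contraNneq nef => ->.
apply/card_le1_eqP => x y; rewrite !inE => /andP[xe xf] /andP[ye yf].
by apply: val_inj; apply: (linear_edgesP _ E_lin e f).
Qed.

Lemma edge_sets_C4_free : C4_free E -> ~~ has_berge_cycle 4 edge_sets.
Proof.
move=> /C4_freeP free; apply/existsP => -[v /existsP[e /and3P[v_inj e_inj cyc]]].
have {}cyc i : exists f, [/\ f \in E, e i = edge_set f,
    val (v i) \in f & val (v (ordS i)) \in f].
  have /forallP/(_ i)/and3P[/edge_setsP[f fE ->]] := cyc.
  by rewrite !inE => ? ?; exists f.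
pose o i : 'I_4 := inord i.
have oS i : i < 3 -> ordS (o i) = o i.+1.
  by move=> i3; apply: val_inj; rewrite /= !inordK ?modn_small //; lia.
have o3 : ordS (o 3) = o 0 by apply: val_inj; rewrite /= !inordK.
have [f0 [f0E def0 a0 b0]] := cyc (o 0).
have [f1 [f1E def1 a1 b1]] := cyc (o 1).
have [f2 [f2E def2 a2 b2]] := cyc (o 2).
have [f3 [f3E def3 a3 b3]] := cyc (o 3).
rewrite oS // in b0; rewrite oS // in b1; rewrite oS // in b2; rewrite o3 in b3.
have oE i j : i < 4 -> j < 4 -> (o i == o j) = (i == j).
  by move=> i4 j4; rewrite -val_eqE /= !inordK.
have nv i j : i < 4 -> j < 4 -> i != j -> val (v (o i)) != val (v (o j)).
  by move=> i4 j4; apply: contraNneq => /val_inj/(injectiveP _ v_inj)/eqP; rewrite oE.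
have ne i j f g : i < 4 -> j < 4 -> i != j ->
    e (o i) = edge_set f -> e (o j) = edge_set g -> f != g.
  move=> i4 j4 nij ef eg; apply: contraNneq nij => fg.
  by move: ef; rewrite fg -eg => /(injectiveP _ e_inj)/eqP; rewrite oE.
apply: (free f0 f1 f2 f3 (v (o 0)) (v (o 1)) (v (o 2)) (v (o 3))) => //.
- rewrite /= !inE !negb_or (ne _ _ _ _ _ _ _ def0 def1) // (ne _ _ _ _ _ _ _ def0 def2) //.
  rewrite (ne _ _ _ _ _ _ _ def0 def3) // (ne _ _ _ _ _ _ _ def1 def2) //.
  by rewrite (ne _ _ _ _ _ _ _ def1 def3) // (ne _ _ _ _ _ _ _ def2 def3).
by rewrite /= !inE !negb_or !nv.
Qed.

(** The new edge [A] closes a path of length 3 between two of its vertices. The adjacent case is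
    vacuous: an old edge through [x] and [y] would meet [A] in two vertices. *)
Lemma linked_berge_cycle (A : {set 'I_k.+1}) (x y : 'I_k.+1) :
  A \notin edge_sets -> linear_hypergraph (A |: edge_sets) ->
  x \in A -> y \in A -> x != y -> linked E x y ->
  has_berge_cycle 4 (A |: edge_sets).
Proof.
move=> nA linA xA yA nxy /orP[/adjacentP[f [fE xf yf]]|].
  have fH : edge_set f \in edge_sets by apply/edge_setsP; exists f.
  move: linA => /forall_inP/(_ A (setU11 _ _)).
  move=> /forall_inP/(_ (edge_set f) (setU1r _ fH)).
  have -> : A != edge_set f by apply: contraNneq nA => ->.
  move=> /card_le1_eqP/(_ x y); rewrite !inE xA yA xf yf => /(_ isT isT) eq_xy.
  by rewrite eq_xy eqxx in nxy.
move=> /berge_path3P[e [f [g [a [b [[eE fE gE] uqe uqx [xe ae af] [bf bg yg]]]]]]].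
have [_ _ /(_ a ae) ak] := edges_inP eE.
have [_ _ /(_ b bg) bk] := edges_inP gE.
pose vs := [:: x; Ordinal (ak : a < k.+1); Ordinal (bk : b < k.+1); y].
pose es := [:: edge_set e; edge_set f; edge_set g; A].
have uqvs : uniq vs by rewrite -(map_inj_uniq val_inj).
have uqes : uniq es.
  (* Reversal puts [A] first, which separates its distinctness from the old edges from their
     distinctness among themselves. *)
  rewrite -(rev_uniq es) /es /rev /= !inE !negb_or.
  have nH h : h \in E -> A != edge_set h.
    by move=> hE; apply: contraNneq nA => ->; apply/edge_setsP; exists h.
  rewrite !nH //=; move: uqe; rewrite /= !inE !negb_or.
  rewrite !(inj_in_eq edge_set_inj) // ![_ == e]eq_sym [g == f]eq_sym.
  by case/and3P=> /andP[-> ->] ->.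
(* The cycle runs [x], [e], [a], [f], [b], [g], [y], [A], back to [x]. The defaults of [nth] are
   never reached. *)
apply/existsP; exists [ffun i : 'I_4 => nth x vs i].
apply/existsP; exists [ffun i : 'I_4 => nth A es i].
apply/and3P; split.
- by apply/injectiveP => i j; rewrite !ffunE => /eqP; rewrite nth_uniq // => /eqP/val_inj.
- by apply/injectiveP => i j; rewrite !ffunE => /eqP; rewrite nth_uniq // => /eqP/val_inj.
have mem h : h \in E -> edge_set h \in A |: edge_sets.
  by move=> hE; rewrite setU1r //; apply/edge_setsP; exists h.
apply/forallP => i; rewrite !ffunE.
case: i => -[|[|[|[|//]]]] i4 /=; rewrite ?mem ?setU11 //= ?inE //=.
- by rewrite xe.
- by rewrite af.
- by rewrite bg.
by rewrite yA.
Qed.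

End Saturation.

(** By the saturation check, any missing triple contains a linked pair, and one such pair already
    yields a 4-cycle once the triple is added. *)
Lemma sat_le_size k E : saturated_edges k E -> sat_lin3_berge_C4 k.+1 <= size E.
Proof.
move=> /and4P[E_in E_lin E_free E_sat].
rewrite /sat_lin3_berge_C4; case: ex_minnP => m _ /(_ #|edge_sets k E|) min_m.
apply: (leq_trans (min_m _)); last first.
  by rewrite /edge_sets cardsE -(size_map (edge_set k)); apply: card_size.
apply/existsP; exists (edge_sets k E); rewrite eqxx andbT; apply/and4P; split.
- exact: edge_sets_uniform.
- exact: edge_sets_linear.
- exact: edge_sets_C4_free.
apply/forallP => A; apply/implyP => /and3P[A3 nA linA].
have memA x : (x \in A) = (x \in enum A) by rewrite mem_enum.
move: (enum_uniq A) memA; move: A3; rewrite cardE.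
case: (enum A) => [|u [|v [|w [|]]]] //= _.
rewrite !inE !negb_or !andbT => /andP[/andP[nuv nuw] nvw] memA.
have uA : u \in A by rewrite memA !inE eqxx.
have vA : v \in A by rewrite memA !inE eqxx !orbT.
have wA : w \in A by rewrite memA !inE eqxx !orbT.
have close := linked_berge_cycle E_in E_lin nA linA.
have ltk (x : 'I_k.+1) : x <= k by rewrite -ltnS.
move: E_sat => /all_verticesP/(_ u (ltk u))/all_verticesP/(_ v (ltk v)).
rewrite val_eqE (negPf nuv) /= => /orP[|/all_verticesP/(_ w (ltk w))].
  exact: close.
rewrite !val_eqE ![w == _]eq_sym (negPf nuw) (negPf nvw) /=.
by case/orP; apply: close.
Qed.

(** * Gluing two hypergraphs at the center 0 *)

Definition shift (k x : nat) : nat := if x is 0 then 0 else x + k.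

(** Since [shift] fixes 0 and moves every other vertex beyond [k], the two sides have exactly the
    center in common. *)
Definition wedge (k : nat) (E G : seq (seq nat)) : seq (seq nat) :=
  E ++ relabel (shift k) G.

Definition rooted (k : nat) (E : seq (seq nat)) : bool :=
  all_vertices k (fun u => [|| u == 0, adjacent E u 0 | berge_path2 E u 0]).

(* In the hypergraphs below, a triple without 0 is a node of the cubic graph of the
   header, with some nodes incomplete: a vertex on a link at 0 may lie in no such
   triple, and a vertex of a triple may lie on no link. *)
Definition pendant := [:: [:: 0; 1; 2]].

Definition fork := [:: [:: 0; 1; 2]; [:: 1; 3; 4]].

Definition claw := [:: [:: 1; 2; 3]; [:: 0; 1; 4]; [:: 0; 2; 5]; [:: 0; 3; 6]].

(* The triangle graph, with one vertex of each node left off the links. *)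
Definition triangle :=
  [:: [:: 1; 2; 3]; [:: 4; 5; 6]; [:: 7; 8; 9];
      [:: 0; 1; 4]; [:: 0; 2; 7]; [:: 0; 5; 8]].

Definition complete4 :=
  [:: [:: 1; 2; 3]; [:: 4; 5; 6]; [:: 7; 8; 9]; [:: 10; 11; 12];
      [:: 0; 1; 4]; [:: 0; 2; 7]; [:: 0; 3; 10];
      [:: 0; 5; 8]; [:: 0; 6; 11]; [:: 0; 9; 12]].

(** The node [[:: 13; 14; 15]] subdivides the edge of K_4 between the first two nodes; its vertex 15
    lies on no link. *)
Definition subdivided_complete4 :=
  [:: [:: 1; 2; 3]; [:: 4; 5; 6]; [:: 7; 8; 9]; [:: 10; 11; 12]; [:: 13; 14; 15];
      [:: 0; 1; 13]; [:: 0; 4; 14]; [:: 0; 2; 7]; [:: 0; 3; 10];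
      [:: 0; 5; 8]; [:: 0; 6; 11]; [:: 0; 9; 12]].

Definition complete33 :=
  [:: [:: 1; 2; 3]; [:: 4; 5; 6]; [:: 7; 8; 9];
      [:: 10; 11; 12]; [:: 13; 14; 15]; [:: 16; 17; 18];
      [:: 0; 1; 10]; [:: 0; 2; 13]; [:: 0; 3; 16];
      [:: 0; 4; 11]; [:: 0; 5; 14]; [:: 0; 6; 17];
      [:: 0; 7; 12]; [:: 0; 8; 15]; [:: 0; 9; 18]].

(** Stronger than being rooted and saturated: every vertex other than 0 needs paths of both lengths
    to the center, and every pair must be linked. Thus a new triple is already settled by a single
    gadget vertex other than 0, wherever its other vertices lie. *)
Definition full_gadget (m : nat) (G : seq (seq nat)) : bool :=
  [&& edges_in m G, linear_edges G, C4_free G,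
      all_vertices m (fun u => (u == 0) || adjacent G u 0 && berge_path2 G u 0) &
      all_vertices m (fun u => all_vertices m (fun w => (u == w) || linked G u w))].


Lemma shift_inj k : injective (shift k).
Proof. by case=> [|x] [|y] //=; lia. Qed.

Lemma ltn_shift k w : 0 < w -> k < shift k w.
Proof. by case: w => //= w _; rewrite addSn ltnS leq_addl. Qed.

Lemma shiftK k v : k < v -> shift k (v - k) = v.
Proof. by rewrite /shift -subn_gt0; case def_v: (v - k) => // _; lia. Qed.

Section Wedge.

Variables (k m : nat) (E G : seq (seq nat)).
Hypotheses (E_in : edges_in k E) (G_in : edges_in m G).

Let W := wedge k E G.

Lemma wedge_subl : {subset E <= W}.
Proof. by move=> e eE; rewrite mem_cat eE. Qed.

Lemma wedge_subr : {subset relabel (shift k) G <= W}.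
Proof. by move=> e eG; rewrite mem_cat eG orbT. Qed.

Lemma relabel_shift_vertex e x :
  e \in relabel (shift k) G -> x \in e -> x = 0 \/ k < x <= k + m.
Proof.
move=> /mapP[f fG ->] /mapP[y yf ->].
have [_ _ /(_ y yf)] := edges_inP G_in fG.
by case: y {yf} => [|y] ym /=; [left | right; lia].
Qed.

Lemma edges_in_wedge : edges_in (k + m) W.
Proof.
apply/allP => e; rewrite mem_cat => /orP[eE|eG].
  have [-> -> le_k] := edges_inP E_in eE.
  by apply/allP => x /le_k xk; apply: leq_trans xk (leq_addr _ _).
have le_km x : x \in e -> x <= k + m.
  by move/(relabel_shift_vertex eG) => [-> //|/andP[]].
case/mapP: eG le_km => f fG -> le_km; have [f3 uqf _] := edges_inP G_in fG.
by rewrite size_map f3 map_inj_uniq ?uqf; [apply/allP | apply: shift_inj].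
Qed.

Lemma edge_two_vertices e (j : nat) : edges_in j W -> e \in W ->
  exists x y, [/\ x \in e, y \in e & x != y].
Proof.
move=> W_in /(edges_inP W_in)[]; case: e => [|x [|y e]] // _ /= /andP[+ _] _.
by rewrite inE negb_or => /andP[nxy _]; exists x, y; rewrite !inE !eqxx orbT.
Qed.

Lemma wedge_common_vertex e f x :
  e \in E -> f \in relabel (shift k) G -> x \in e -> x \in f -> x = 0.
Proof.
move=> /(edges_inP E_in)[_ _ le_k] fG /le_k xk /(relabel_shift_vertex fG).
by case=> // /andP[]; lia.
Qed.

(** A vertex other than the center determines its side; this lets the side propagate from edge to
    edge along a cycle. *)
Lemma wedge_same_side e f x : e \in W -> f \in W -> x \in e -> x \in f -> x != 0 ->
  (e \in E) = (f \in E).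
Proof.
rewrite !mem_cat => eW fW xe xf nx0.
case eE: (e \in E) eW; case fE: (f \in E) fW => //= fG eG.
  by rewrite (wedge_common_vertex eE fG xe xf) in nx0.
by rewrite (wedge_common_vertex fE eG xf xe) in nx0.
Qed.

Lemma wedge_disjoint e : e \in E -> e \in relabel (shift k) G -> False.
Proof.
move=> eE eG.
have [x [y [xe ye]]] := edge_two_vertices edges_in_wedge (wedge_subl eE).
by rewrite (wedge_common_vertex eE eG xe xe) (wedge_common_vertex eE eG ye ye).
Qed.

(** Of two vertices shared by two edges, one is not 0 and puts both edges on the same side. *)
Lemma linear_wedge : linear_edges E -> linear_edges G -> linear_edges W.
Proof.
move=> /linear_edgesP linE /(relabel_linear (@shift_inj k))/linear_edgesP linG.
apply/linear_edgesP => e f eW fW nef x y xe xf ye yf; apply/eqP/contraT => nxy.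
have [z [ze zf nz0]] : exists z, [/\ z \in e, z \in f & z != 0].
  case: (eqVneq x 0) => [x0|]; last by exists x.
  by exists y; rewrite -x0 eq_sym.
have := wedge_same_side eW fW ze zf nz0; move: eW fW; rewrite !mem_cat.
case eE: (e \in E) => /=; case fE: (f \in E) => //= eG fG _.
  by rewrite (linE e f eE fE nef x y) ?eqxx in nxy.
by rewrite (linG e f eG fG nef x y) ?eqxx in nxy.
Qed.

(* A cycle on distinct vertices passes at most once through the cut vertex
   0, so all its edges lie on one side. *)
Lemma C4_free_wedge : C4_free E -> C4_free G -> C4_free W.
Proof.
move=> /C4_freeP freeE /(relabel_C4_free (@shift_inj k))/C4_freeP freeG.
apply/C4_freeP => e1 e2 e3 e4 x1 x2 x3 x4 [e1W e2W e3W e4W] uqe uqx.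
move=> inx iny; have [x11 x21 x22 x32] := inx; have [x33 x43 x44 x14] := iny.
have [s2 s3 s4] : [/\ (e2 \in E) = (e1 \in E), (e3 \in E) = (e1 \in E) &
                     (e4 \in E) = (e1 \in E)].
  have t1 := wedge_same_side e4W e1W x14 x11.
  have t2 := wedge_same_side e1W e2W x21 x22.
  have t3 := wedge_same_side e2W e3W x32 x33.
  have t4 := wedge_same_side e3W e4W x43 x44.
  move: uqx; rewrite /= !inE !negb_or !andbT.
  move=> /andP[/and3P[n12 n13 n14] /andP[/andP[n23 n24] n34]].
  case: (eqVneq x1 0) => [x10|/t1 {}t1].
    rewrite x10 ![0 == _]eq_sym in n12 n13 n14.
    by rewrite -(t4 n14) -(t3 n13) -(t2 n12).
  case: (eqVneq x2 0) => [x20|/t2 {}t2].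
    by rewrite x20 ![0 == _]eq_sym in n23 n24; rewrite (t3 n23) (t4 n24) t1.
  case: (eqVneq x3 0) => [x30|/t3 {}t3].
    by rewrite x30 ![0 == _]eq_sym in n34; rewrite (t4 n34) t1 -t2.
  by rewrite -t3 -t2 t1.
move: e1W e2W e3W e4W; rewrite !mem_cat s2 s3 s4.
case e1E: (e1 \in E) => /= e1W e2W e3W e4W.
  by apply: (freeE e1 e2 e3 e4 x1 x2 x3 x4) => //; rewrite s2 s3 s4 e1E.
exact: (freeG e1 e2 e3 e4 x1 x2 x3 x4).
Qed.

(* Within its own part, u is joined to the center by a path of length 1 or 2, and
   w by paths of both lengths: pick the one making the total length 3. *)
Lemma linked_across u w : 0 < u <= k -> 0 < w <= m ->
  adjacent E u 0 || berge_path2 E u 0 -> adjacent G w 0 -> berge_path2 G w 0 ->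
  linked W u (shift k w).
Proof.
move=> /andP[u0 uk] /andP[w0 wm] rooted_u adj path.
have {adj} /adjacentP[f1 [f1G wf1 zf1]] := relabel_adjacent (shift k) adj.
have {path} /berge_path2P := relabel_path2 (@shift_inj k) path.
move=> [g1 [g2 [y [g1G g2G ng uqy [wg1 yg1 yg2 zg2]]]]].
rewrite /= in zf1 zg2 uqy.
have w_gt := ltn_shift k w0.
have nEG e f : e \in E -> f \in relabel (shift k) G -> e != f.
  by move=> eE fG; apply: contraTneq fG => <-; apply/negP/wedge_disjoint.
have nuw : u != shift k w by rewrite neq_ltn (leq_ltn_trans uk w_gt).
apply/orP; right; apply/berge_path3P.
case/orP: rooted_u => [/adjacentP[e [eE ue ze]]|].
  exists e, g2, g1, 0, y; split=> //.
  - by rewrite (wedge_subl eE) !wedge_subr.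
  - by rewrite /= !inE negb_or !(nEG e) //= eq_sym ng.
  move: uqy; rewrite /= !inE !negb_or !andbT => /andP[/andP[nwy nw0] ny0].
  have nuy : u != y.
    case: (relabel_shift_vertex g1G yg1) => [y0|/andP[ky _]]; first by rewrite y0 in ny0.
    by rewrite neq_ltn (leq_ltn_trans uk ky).
  by rewrite nuw nuy -lt0n u0 ![0 == _]eq_sym ny0 nw0 eq_sym.
move=> /berge_path2P[e1 [e2 [x [e1E e2E ne uqx [ue1 xe1 xe2 ze2]]]]].
exists e1, e2, f1, x, 0; split=> //.
- by rewrite (wedge_subl e1E) (wedge_subl e2E) wedge_subr.
- by rewrite /= !inE negb_or ne !nEG.
have [_ _ /(_ x xe1) xk] := edges_inP E_in e1E.
move: uqx; rewrite /= !inE !negb_or !andbT => /andP[/andP[-> ->] ->].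
rewrite nuw /= [0 == _]eq_sym -lt0n (leq_trans _ w_gt) // andbT.
by rewrite neq_ltn (leq_ltn_trans xk w_gt).
Qed.

(** A triple within the first side keeps the linked pair that saturation of [E] provides. Any other
    triple has a vertex beyond [k], which is linked to all others. *)
Lemma wedge_saturated :
  rooted k E -> saturated_edges k E -> full_gadget m G ->
  rooted (k + m) W /\ saturated_edges (k + m) W.
Proof.
move=> /all_verticesP rootE /and4P[_ linE freeE satE].
move=> /and5P[_ linG freeG /all_verticesP rootG /all_verticesP linkG].
have right v : k < v -> v <= k + m -> exists2 w, 0 < w <= m & v = shift k w.
  move=> kv vkm; exists (v - k); last by rewrite shiftK.
  by rewrite subn_gt0 kv leq_subLR.
split.
  apply/all_verticesP => v vkm; have [vk|kv] := leqP v k.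
    case/or3P: (rootE v vk) => [-> //|/(adjacent_sub wedge_subl) ->|]; first by rewrite orbT.
    by move/(berge_path2_sub wedge_subl) ->; rewrite !orbT.
  have [w /andP[w0 wm] ->] := right v kv vkm.
  move: (rootG w wm); rewrite eqn0Ngt w0 /= => /andP[/(relabel_adjacent (shift k)) adj _].
  by rewrite (adjacent_sub wedge_subr adj) orbT.
apply/and4P; split; first exact: edges_in_wedge.
- exact: linear_wedge.
- exact: C4_free_wedge.
have link_right u v : u <= k + m -> k < v <= k + m -> u != v -> linked W u v.
  move=> ukm /andP[kv vkm] nuv; have [w w_in def_v] := right v kv vkm.
  have /andP[w0 wm] := w_in.
  have within u' : u' <= m -> u = shift k u' -> linked W u v.
    move=> u'm def_u; move: nuv (linkG u' u'm) => /[swap]/all_verticesP/(_ w wm).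
    rewrite def_u def_v (inj_eq (@shift_inj k)) => /orP[->//|/(relabel_linked (@shift_inj k))].
    by move/(linked_sub wedge_subr).
  (* The center lies on both sides and is treated here as a gadget vertex. *)
  have [u_0|u0] := posnP u; first exact: (within 0).
  have [uk|ku] := leqP u k; last first.
    by have [u' /andP[_ u'm]] := right u ku ukm; apply: within.
  move: (rootG w wm); rewrite def_v eqn0Ngt w0 /= => /andP[adj path].
  apply: linked_across => //; first by rewrite u0.
  by have := rootE u uk; rewrite eqn0Ngt u0.
apply/all_verticesP => u ukm; apply/all_verticesP => v vkm.
case: (eqVneq u v) => //= nuv.
have [vk|kv] := leqP v k; last by rewrite link_right ?kv.
have [uk|ku] := leqP u k; last by rewrite linked_sym link_right ?ku // eq_sym.
move: satE => /all_verticesP/(_ u uk)/all_verticesP/(_ v vk).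
rewrite (negPf nuv) /= => /orP[/(linked_sub wedge_subl) -> //|/all_verticesP satE].
apply/orP; right; apply/all_verticesP => w wkm.
have [wk|kw] := leqP w k; last first.
  by case: (eqVneq w u) => //= nwu; rewrite link_right ?kw ?orbT // eq_sym.
by case/or4P: (satE w wk) => [->|->|/(linked_sub wedge_subl)->|/(linked_sub wedge_subl)->];
  rewrite ?orbT.
Qed.

End Wedge.

(** * Repeated gluing of full gadgets, and the arithmetic of the bound *)

Definition rooted_saturated (k : nat) (E : seq (seq nat)) : bool :=
  rooted k E && saturated_edges k E.

Lemma full_complete4 : full_gadget 12 complete4. Proof. by lazy. Qed.

Lemma full_complete33 : full_gadget 18 complete33. Proof. by lazy. Qed.

Lemma wedge_full_gadget k m E G : rooted_saturated k E -> full_gadget m G ->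
  rooted_saturated (k + m) (wedge k E G).
Proof.
move=> /andP[rootE satE] fullG; apply/andP; apply: wedge_saturated => //.
  by case/and4P: satE.
by case/and5P: fullG.
Qed.

(** A copy obtained from K_4 uses up 2 units of [t]. Subtracting 2 leaves the forbidden value 1 only
    from [t = 3], where one copy obtained from K_{3,3} is glued instead. *)
Lemma rooted_saturated_extend t k E : t != 1 -> rooted_saturated k E ->
  exists2 E', rooted_saturated (k + 6 * t) E' & size E' = size E + 5 * t.
Proof.
elim/ltn_ind: t k E => t IHt k E nt1 RE.
have step m G s : rooted_saturated (k + m) (wedge k E G) -> 6 * s = m ->
    size G = 5 * s -> s <= t -> 0 < s -> t - s != 1 ->
    exists2 E', rooted_saturated (k + 6 * t) E' & size E' = size E + 5 * t.
  move=> RW sm sG st s0 nts; have [|E' RE' sE'] := IHt (t - s) _ _ _ nts RW; first lia.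
  exists E'; first by have -> : k + 6 * t = k + m + 6 * (t - s) by lia.
  by rewrite sE' size_cat size_map sG; lia.
have [->|t0] := posnP t; first by exists E; rewrite ?muln0 ?addn0.
have [->|nt3] := eqVneq t 3.
  exists (wedge k E complete33); first exact: (wedge_full_gadget RE full_complete33).
  by rewrite size_cat.
by apply: (step 12 _ 2 (wedge_full_gadget RE full_complete4)) => //; lia.
Qed.

Lemma sat_le_extend t k E : t != 1 -> rooted_saturated k E ->
  sat_lin3_berge_C4 (k + 6 * t).+1 <= size E + 5 * t.
Proof.
by move=> nt1 /(rooted_saturated_extend nt1)[E' /andP[_ satE'] <-]; apply: sat_le_size.
Qed.

(** Each residue [s] modulo 6 splits into three classes modulo 18; the listed constant, less 3, is
    the worst of the three offsets from [5 * q]. Adding 3 on the right avoids negative numbers. *)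
Lemma sat_bound_ge q s : s < 6 ->
  5 * q + nth 0 [:: 0; 1; 1; 3; 3; 4] s <= sat_bound (6 * q + s) + 3.
Proof.
move=> s6; set n := 6 * q + s.
have n18 : n = 18 * (n %/ 18) + n %% 18 by rewrite mulnC -divn_eq.
have r18 : n %% 18 < 18 by rewrite ltn_mod.
rewrite /sat_bound; move: n18 r18; rewrite /n {n}.
move: (_ %/ 18) (_ %% 18) => p r.
(* Each [r] is compatible with only one [s]; for the others the two expressions of the order
   disagree modulo 6. *)
do 18?[case: r => [|r]; first by
  case: s s6 => [|[|[|[|[|[|//]]]]]] _ def_n _ /=; rewrite ?def_n; lia].
by [].
Qed.

(** * Starting hypergraphs, and small orders treated separately *)

Lemma rooted_saturated_single : rooted_saturated 0 [::].
Proof. by lazy. Qed.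

Lemma rooted_saturated_pendant : rooted_saturated 2 pendant.
Proof. by lazy. Qed.

(** In this wedge and those below, the second part is not a full gadget, so [wedge_saturated] does
    not apply and saturation is checked by evaluation. *)
Lemma rooted_saturated_pendant2 : rooted_saturated 4 (wedge 2 pendant pendant).
Proof. by lazy. Qed.

Lemma rooted_saturated_pendant_claw : rooted_saturated 8 (wedge 2 pendant claw).
Proof. by lazy. Qed.

Lemma rooted_saturated_triangle : rooted_saturated 9 triangle.
Proof. by lazy. Qed.

Lemma rooted_saturated_fork_claw : rooted_saturated 10 (wedge 4 fork claw).
Proof. by lazy. Qed.

Lemma rooted_saturated_pendant_triangle :
  rooted_saturated 11 (wedge 2 pendant triangle).
Proof. by lazy. Qed.

Lemma rooted_saturated_claw2 : rooted_saturated 12 (wedge 6 claw claw).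
Proof. by lazy. Qed.

Lemma rooted_saturated_pendant2_triangle :
  rooted_saturated 13 (wedge 4 (wedge 2 pendant pendant) triangle).
Proof. by lazy. Qed.

Lemma rooted_saturated_claw_triangle :
  rooted_saturated 15 (wedge 6 claw triangle).
Proof. by lazy. Qed.

Lemma rooted_saturated_pendant_subdivided :
  rooted_saturated 17 (wedge 2 pendant subdivided_complete4).
Proof. by lazy. Qed.

Lemma rooted_saturated_pendant2_subdivided :
  rooted_saturated 19 (wedge 4 (wedge 2 pendant pendant) subdivided_complete4).
Proof. by lazy. Qed.

(** These orders are smaller than the start that serves the large orders of their class modulo 6.
    Nothing is glued on afterwards, so vertices that do not reach 0 are allowed. *)
Lemma sat_le_small n :
  n \in [:: 2; 4; 6; 7; 8; 10] -> sat_lin3_berge_C4 n <= sat_bound n.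
Proof.
have small k E : saturated_edges k E -> size E <= sat_bound k.+1 ->
    sat_lin3_berge_C4 k.+1 <= sat_bound k.+1.
  by move=> /sat_le_size; apply: leq_trans.
rewrite !inE; do 5?[case/orP=> [/eqP->|]]; last move/eqP->.
(* The edge list does not fix the order: [pendant] leaves vertex 3 isolated for [n = 4], and [claw]
   serves [n = 7] and, with vertex 7 isolated, [n = 8]. *)
- by apply: (small _ [::]); lazy.
- by apply: (small _ pendant); lazy.
- by apply: (small _ [:: [:: 0; 1; 2]; [:: 3; 4; 5]]); lazy.
- by apply: (small _ claw); lazy.
- by apply: (small _ claw); lazy.
by apply: (small _ ([:: 7; 8; 9] :: claw)); lazy.
Qed.

Theorem theorem1p4 (n : nat) (n_ge1 : 1 <= n) (n_neq3 : n <> 3) :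
  sat_lin3_berge_C4 n <= sat_bound n.
Proof.
have [|not_small] := boolP (n \in [:: 2; 4; 6; 7; 8; 10]); first exact: sat_le_small.
have extend t k E : t != 1 -> rooted_saturated k E -> n = (k + 6 * t).+1 ->
    size E + 5 * t <= sat_bound n -> sat_lin3_berge_C4 n <= sat_bound n.
  by move=> nt1 /(sat_le_extend nt1) le_sat -> ; apply: leq_trans.
move: (divn_eq n 6) (ltn_pmod n (isT : 0 < 6)).
move: (n %/ 6) (n %% 6) => q s def_n s6; rewrite mulnC in def_n.
move: (sat_bound_ge q s6); rewrite -def_n => le_bound.
(* In each class the last start has an edge count that meets [le_bound] exactly, for instance 7 +
   5(q - 2) = 5q - 3 when [s = 0]. The value of [q] that would force [t = 1] gets another start,
   compared with [sat_bound] directly; so do the orders 1 and 5, which lie below the general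
   start. *)
case: s s6 def_n le_bound => [|[|[|[|[|[|//]]]]]] _ def_n /= le_bound.
- have [q3|nq3] := eqVneq q 3.
    by apply: (extend 0 _ _ _ rooted_saturated_pendant_subdivided); rewrite ?def_n ?q3.
  by apply: (extend (q - 2) _ _ _ rooted_saturated_pendant_triangle);
    rewrite /=; move: not_small; rewrite !inE; lia.
- have [q0|nq0] := eqVneq q 0.
    by apply: (extend 0 _ _ _ rooted_saturated_single); rewrite ?def_n ?q0.
  have [q3|nq3] := eqVneq q 3.
    by apply: (extend 3 _ _ _ rooted_saturated_single); rewrite ?def_n ?q3.
  by apply: (extend (q - 2) _ _ _ rooted_saturated_claw2);
    rewrite /=; move: not_small; rewrite !inE; lia.
- have [q3|nq3] := eqVneq q 3.
    by apply: (extend 0 _ _ _ rooted_saturated_pendant2_subdivided); rewrite ?def_n ?q3.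
  by apply: (extend (q - 2) _ _ _ rooted_saturated_pendant2_triangle);
    rewrite /=; move: not_small; rewrite !inE; lia.
- have [q2|nq2] := eqVneq q 2.
    by apply: (extend 2 _ _ _ rooted_saturated_pendant); rewrite ?def_n ?q2.
  (* The case [q = 0] is the excluded order 3. *)
  by apply: (extend (q - 1) _ _ _ rooted_saturated_pendant_claw);
    rewrite /=; move: not_small; rewrite !inE; lia.
- have [q3|nq3] := eqVneq q 3.
    by apply: (extend 2 _ _ _ rooted_saturated_triangle); rewrite ?def_n ?q3.
  by apply: (extend (q - 2) _ _ _ rooted_saturated_claw_triangle);
    rewrite /=; move: not_small; rewrite !inE; lia.
have [q0|nq0] := eqVneq q 0.
  by apply: (extend 0 _ _ _ rooted_saturated_pendant2); rewrite ?def_n ?q0.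
have [q2|nq2] := eqVneq q 2.
  by apply: (extend 2 _ _ _ rooted_saturated_pendant2); rewrite ?def_n ?q2.
by apply: (extend (q - 1) _ _ _ rooted_saturated_fork_claw);
  rewrite /=; move: not_small; rewrite !inE; lia.
Qed.
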